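(* Let $n\ge 1$, $r\ge 1$, let $0=d_1\le d_2\le\cdots\le d_r$ be integers, and put $N=n+d_r$. Let $k$ be a field, $E=\bigwedge(k^n)$, and let $F=\bigoplus_{i=1}^r Eg_i$ be the graded free $E$-module with $\deg g_i=d_i$. Then $$\bigl\{H_{F/M}: M \text{ a proper monomial submodule of } F\bigr\}=\bigl\{\operatorname{ff}(\vec\Delta):\vec\Delta \text{ an } r\text{-vector of simplicial complexes on }[n]\bigr\},$$ and both sets are equal to $$S_n+\operatorname{shift}^{d_2}(S_n)+\cdots+\operatorname{shift}^{d_r}(S_n),$$ an ordinary Minkowski sum of finite subsets of $\mathbb Z^{N+1}$, the sum being over the multiset $\{d_1,\dots,d_r\}$, so that repeated degrees contribute repeated summands (the summand $S_n$ corresponding to $d_1=0$ means $\operatorname{shift}^0(S_n)$).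
   Context: $[n]=\{1,\dots,n\}$. $E=\bigwedge(k^n)$ is the exterior algebra on generators $e_1,\dots,e_n$, graded with $\deg e_i=1$; for $\sigma=\{s_1<\cdots<s_j\}\subseteq[n]$, $e_\sigma=e_{s_1}\wedge\cdots\wedge e_{s_j}$. Monomials of $F$ are the $e_\sigma g_i$, of degree $|\sigma|+d_i$. For a graded submodule $M\subseteq F$, $H_{F/M}(j)=\dim_k(F/M)_j$, viewed as the vector $(H_{F/M}(0),\dots,H_{F/M}(N))\in\mathbb Z^{N+1}$. A monomial submodule of $F$ is a submodule generated by monomials of $F$; it has the form $M=I_1g_1\oplus\cdots\oplus I_rg_r$ with each $I_i\subseteq E$ a monomial ideal. It is proper if each $I_i$ has no minimal generator of degree $\le 1$, i.e. $(I_i)_{\le 1}=0$ for every $i$. A simplicial complex on $[n]$ is a family $\Delta$ of subsets of $[n]$, closed under taking subsets, containing $\emptyset$ and every singleton $\{i\}$, $i\in[n]$; $\mathcal S_n$ is the set of these. $f_j(\Delta)$ is the number of $\sigma\in\Delta$ with $|\sigma|=j$, with $f_j(\Delta)=0$ for $j<0$ or $j>n$. $S_n=\{(f_0(\Delta),f_1(\Delta),\dots,f_n(\Delta)):\Delta\in\mathcal S_n\}\subseteq\mathbb Z^{n+1}$. An $r$-vector of simplicial complexes on $[n]$ is a tuple $\vec\Delta=(\Delta_1,\dots,\Delta_r)$ with $\Delta_i\in\mathcal S_n$ chosen independently; its $\mathrm{ff}$-vector is $\operatorname{ff}(\vec\Delta)_j=\sum_{i=1}^r f_{j-d_i}(\Delta_i)$,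 $j=0,\dots,N$. $\operatorname{shift}^d:\mathbb R^{n+1}\to\mathbb R^{N+1}$ is the linear map that prepends $d$ zeros and pads with zeros on the right (with coordinates indexed from $0$, $e_j\mapsto e_{j+d}$). *)

(* Defs.v *)
From HB Require Import structures.
From mathcomp Require Import all_classical.
From mathcomp Require Import all_boot all_order all_algebra all_field.

Set Implicit Arguments.
Unset Strict Implicit.
Unset Printing Implicit Defensive.

Import Order.TTheory GRing.Theory Num.Theory.
Local Open Scope ring_scope.

(******************************************************************************)
(* The set [n] = {1, ..., n} is represented by 'I_n = {0, ..., n-1}.          *)
(*                                                                            *)
(* [exterior k n] is the exterior algebra on k^n, presented on its standard   *)
(* basis: an element is its family of coordinates on the e_s, s a subset of   *)
(* 'I_n.  Its product is the bilinear extension of                            *)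
(*    e_s e_t = (-1)^(inversions s t) e_(s U t)   if s, t are disjoint,       *)
(*    e_s e_t = 0                                 otherwise,                  *)
(* where inversions s t counts the transpositions needed to sort the word     *)
(* s followed by t.  It is shown below to be an associative unital algebra    *)
(* generated by the e_i, with v ^ v = 0 for v of degree 1, in which e_s is    *)
(* the increasing product of the e_i, i in s.                                 *)
(******************************************************************************)

Definition inversions n (s t : {set 'I_n}) : nat :=
  (\sum_(i in s) \sum_(j in t) (j < i))%N.

Definition exterior (k : fieldType) (n : nat) : Type :=
  {ffun {set 'I_n} -> k^o}.

HB.instance Definition _ (k : fieldType) n :=
  Vector.on (exterior k n).

Section ExteriorAlgebra.
Variables (k : fieldType) (n : nat).
Implicit Types (s t u : {set 'I_n}) (x y z : exterior k n).

Definition ext_coef x s : k := (x : {ffun _}) s.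

Definition ext_mon s : exterior k n := [ffun t => (t == s)%:R].

Definition ext_mon_mul s t : exterior k n :=
  if [disjoint s & t] then (-1) ^+ inversions s t *: ext_mon (s :|: t) else 0.

Definition ext_mul x y : exterior k n :=
  \sum_s \sum_t (ext_coef x s * ext_coef y t) *: ext_mon_mul s t.

Lemma ext_coefD x y s : ext_coef (x + y) s = ext_coef x s + ext_coef y s.
Proof. exact: ffunE. Qed.

Lemma ext_coefZ a x s : ext_coef (a *: x) s = a * ext_coef x s.
Proof. exact: ffunE. Qed.

Lemma ext_coef_mon s t : ext_coef (ext_mon s) t = (t == s)%:R.
Proof. exact: ffunE. Qed.

Lemma ext_expand x : x = \sum_s ext_coef x s *: ext_mon s.
Proof.
apply/ffunP => t; rewrite sum_ffunE (bigD1 t) //= big1 ?addr0.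
  by rewrite !ffunE eqxx /GRing.scale /= mulr1.
by move=> s nst; rewrite !ffunE eq_sym (negPf nst) scaler0.
Qed.

Lemma ext_mulDl x y z : ext_mul (x + y) z = ext_mul x z + ext_mul y z.
Proof.
rewrite /ext_mul -big_split; apply: eq_bigr => s _ /=.
rewrite -big_split; apply: eq_bigr => t _ /=.
by rewrite ext_coefD mulrDl scalerDl.
Qed.

Lemma ext_mulDr x y z : ext_mul x (y + z) = ext_mul x y + ext_mul x z.
Proof.
rewrite /ext_mul -big_split; apply: eq_bigr => s _ /=.
rewrite -big_split; apply: eq_bigr => t _ /=.
by rewrite ext_coefD mulrDr scalerDl.
Qed.

Lemma ext_mulZl (a : k) x y : ext_mul (a *: x) y = a *: ext_mul x y.
Proof.
rewrite /ext_mul scaler_sumr; apply: eq_bigr => s _ /=.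
rewrite scaler_sumr; apply: eq_bigr => t _ /=.
by rewrite ext_coefZ scalerA mulrA.
Qed.

Lemma ext_mulZr (a : k) x y : ext_mul x (a *: y) = a *: ext_mul x y.
Proof.
rewrite /ext_mul scaler_sumr; apply: eq_bigr => s _ /=.
rewrite scaler_sumr; apply: eq_bigr => t _ /=.
by rewrite ext_coefZ scalerA mulrCA.
Qed.

Lemma ext_mul0l x : ext_mul 0 x = 0.
Proof. by rewrite -{1}(scale0r x) ext_mulZl scale0r. Qed.

Lemma ext_mul0r x : ext_mul x 0 = 0.
Proof. by rewrite -{1}(scale0r x) ext_mulZr scale0r. Qed.

Lemma ext_mul_suml (I : finType) (P : pred I) (F : I -> exterior k n) y :
  ext_mul (\sum_(i | P i) F i) y = \sum_(i | P i) ext_mul (F i) y.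
Proof.
apply: (big_morph (ext_mul^~ y)) => [x z|]; [exact: ext_mulDl|exact: ext_mul0l].
Qed.

Lemma ext_mul_sumr (I : finType) (P : pred I) (F : I -> exterior k n) y :
  ext_mul y (\sum_(i | P i) F i) = \sum_(i | P i) ext_mul y (F i).
Proof.
apply: (big_morph (ext_mul y)) => [x z|]; [exact: ext_mulDr|exact: ext_mul0r].
Qed.

Lemma ext_mul_mon s t : ext_mul (ext_mon s) (ext_mon t) = ext_mon_mul s t.
Proof.
rewrite /ext_mul (bigD1 s) //= [X in _ + X]big1 ?addr0; last first.
  move=> u nus; rewrite big1 // => v _.
  by rewrite ext_coef_mon (negPf nus) mul0r scale0r.
rewrite (bigD1 t) //= [X in _ + X]big1 ?addr0; last first.
  by move=> v nvt; rewrite !ext_coef_mon (negPf nvt) mulr0 scale0r.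
by rewrite !ext_coef_mon !eqxx mulr1 scale1r.
Qed.

Lemma inversionsUl s t u : [disjoint s & t] ->
  inversions (s :|: t) u = (inversions s u + inversions t u)%N.
Proof.
by move=> dst; rewrite /inversions (eq_bigl [predU s & t]) ?bigU // => i;
  rewrite !inE.
Qed.

Lemma inversionsUr s t u : [disjoint t & u] ->
  inversions s (t :|: u) = (inversions s t + inversions s u)%N.
Proof.
move=> dtu; rewrite /inversions -big_split; apply: eq_bigr => i _ /=.
by rewrite (eq_bigl [predU t & u]) ?bigU // => j; rewrite !inE.
Qed.

Lemma disjointUl s t u :
  [disjoint s :|: t & u] = [disjoint s & u] && [disjoint t & u].
Proof. by rewrite -!setI_eq0 setIUl setU_eq0. Qed.

Lemma ext_mul_monA s t u :
  ext_mul (ext_mon s) (ext_mul (ext_mon t) (ext_mon u)) =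
  ext_mul (ext_mul (ext_mon s) (ext_mon t)) (ext_mon u).
Proof.
rewrite !ext_mul_mon /ext_mon_mul.
have [dtu|ndtu] := boolP [disjoint t & u]; last first.
  rewrite ext_mul0r; case: ifP => _; last by rewrite ext_mul0l.
  rewrite ext_mulZl ext_mul_mon /ext_mon_mul disjointUl (negPf ndtu) andbF.
  by rewrite scaler0.
have [dst|ndst] := boolP [disjoint s & t]; last first.
  rewrite ext_mul0l ext_mulZr ext_mul_mon /ext_mon_mul disjoint_sym disjointUl.
  by rewrite [[disjoint t & s]]disjoint_sym (negPf ndst) scaler0.
rewrite ext_mulZr ext_mulZl !ext_mul_mon /ext_mon_mul disjointUl dtu andbT.
rewrite disjoint_sym disjointUl [[disjoint t & s]]disjoint_sym dst /=.
rewrite [[disjoint u & s]]disjoint_sym.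
have [dsu|_] := boolP [disjoint s & u]; last by rewrite !scaler0.
rewrite !scalerA -!exprD setUA inversionsUl // inversionsUr //.
by congr ((-1) ^+ _ *: _); rewrite addnC -addnA.
Qed.

Lemma ext_mulA : associative ext_mul.
Proof.
move=> x y z; rewrite (ext_expand x) (ext_mul_suml _ _ y) !ext_mul_suml.
apply: eq_bigr => s _.
rewrite !ext_mulZl; congr (_ *: _).
rewrite (ext_expand y) (ext_mul_suml _ _ z) !(ext_mul_sumr _ _ (ext_mon s)).
rewrite ext_mul_suml.
apply: eq_bigr => t _; rewrite !(ext_mulZl, ext_mulZr); congr (_ *: _).
rewrite (ext_expand z) (ext_mul_sumr _ _ (ext_mon t)) !ext_mul_sumr; apply: eq_bigr => u _.
by rewrite !ext_mulZr ext_mul_monA.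
Qed.

Lemma inversions0l s : inversions set0 s = 0%N.
Proof. by rewrite /inversions big_set0. Qed.

Lemma inversions0r s : inversions s set0 = 0%N.
Proof. by rewrite /inversions big1 // => i _; rewrite big_set0. Qed.

Lemma ext_mul1l : left_id (ext_mon set0) ext_mul.
Proof.
move=> x; rewrite {1}(ext_expand x) ext_mul_sumr [RHS]ext_expand.
apply: eq_bigr => s _; rewrite ext_mulZr ext_mul_mon /ext_mon_mul.
by rewrite -setI_eq0 set0I eqxx inversions0l expr0 scale1r set0U.
Qed.

Lemma ext_mul1r : right_id (ext_mon set0) ext_mul.
Proof.
move=> x; rewrite {1}(ext_expand x) ext_mul_suml [RHS]ext_expand.
apply: eq_bigr => s _; rewrite ext_mulZl ext_mul_mon /ext_mon_mul.
by rewrite -setI_eq0 setI0 eqxx inversions0r expr0 scale1r setU0.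
Qed.

Lemma ext_1_neq0 : ext_mon set0 != 0.
Proof.
apply/eqP => /ffunP/(_ set0); rewrite !ffunE eqxx.
by apply/eqP; exact: oner_neq0.
Qed.

End ExteriorAlgebra.

HB.instance Definition _ (k : fieldType) n :=
  GRing.Zmodule_isNzRing.Build (exterior k n)
    (@ext_mulA k n) (@ext_mul1l k n) (@ext_mul1r k n)
    (@ext_mulDl k n) (@ext_mulDr k n) (@ext_1_neq0 k n).

HB.instance Definition _ (k : fieldType) n :=
  GRing.Lmodule_isLalgebra.Build k (exterior k n)
    (fun a x y => esym (ext_mulZl a x y)).

HB.instance Definition _ (k : fieldType) n :=
  GRing.Lalgebra_isAlgebra.Build k (exterior k n)
    (fun a x y => esym (ext_mulZr a x y)).

HB.instance Definition _ (k : fieldType) n :=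
  Algebra_isFalgebra.Build k (exterior k n).

Section ExteriorFacts.
Variables (k : fieldType) (n : nat).
Implicit Types (s t : {set 'I_n}) (i j : 'I_n) (x y : exterior k n).

Lemma ext_monM s t : ext_mon k s * ext_mon k t = ext_mon_mul k s t.
Proof. exact: ext_mul_mon. Qed.

Lemma ext_gen_sq i : ext_mon k [set i] * ext_mon k [set i] = 0.
Proof.
by rewrite ext_monM /ext_mon_mul -setI_eq0 setIid -cards_eq0 cards1.
Qed.

Lemma ext_gen_anticomm i j :
  ext_mon k [set i] * ext_mon k [set j] = - (ext_mon k [set j] * ext_mon k [set i]).
Proof.
have [->|nij] := eqVneq i j; first by rewrite ext_gen_sq oppr0.
rewrite !ext_monM /ext_mon_mul !disjoints1 !inE (eq_sym j i) nij /=.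
rewrite /inversions !big_set1 (setUC [set j]) -scaleNr.
by case: (ltngtP i j) (nij) => [||/val_inj->] //=; rewrite ?eqxx // expr0 expr1 ?opprK.
Qed.

Lemma ext_deg1_sq (c : 'I_n -> k) :
  (\sum_i c i *: ext_mon k [set i]) * (\sum_i c i *: ext_mon k [set i]) = 0.
Proof.
pose e i := ext_mon k [set i].
suff H (l : seq 'I_n) :
  (\sum_(i <- l) c i *: e i) * (\sum_(i <- l) c i *: e i) = 0 by exact: H.
elim: l => [|i l IHl]; first by rewrite big_nil mul0r.
rewrite big_cons mulrDl !mulrDr IHl addr0.
have -> : (c i *: e i) * (c i *: e i) = 0.
  by rewrite -scalerAl -scalerAr ext_gen_sq !scaler0.
rewrite add0r mulr_sumr mulr_suml -big_split big1 // => j _ /=.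
rewrite -!scalerAl -!scalerAr ext_gen_anticomm !scalerN !scalerA mulrC.
by rewrite addNr.
Qed.

Lemma ext_mon_prod s : ext_mon k s = \prod_(i <- enum s) ext_mon k [set i].
Proof.
have sl : sorted (relpre val ltn) (enum s).
  rewrite /enum_mem; apply: sorted_filter => [i j l|]; first exact: ltn_trans.
  by rewrite -enumT -sorted_map val_enum_ord iota_ltn_sorted.
suff H (l : seq 'I_n) : sorted (relpre val ltn) l ->
    ext_mon k [set i in l] = \prod_(i <- l) ext_mon k [set i].
  by rewrite -(H _ sl); congr (ext_mon k _); apply/setP => i; rewrite inE mem_enum.
elim: l => [_|i l IHl] /=.
  by rewrite big_nil -[RHS]/(ext_mon k set0); congr (ext_mon k _).
rewrite path_sortedE => [|a b c]; last exact: ltn_trans.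
move=> /andP[/allP il /IHl {}IHl]; rewrite big_cons -IHl ext_monM /ext_mon_mul.
rewrite disjoints1 inE; case: ifPn => [_|/negPn/il]; last by rewrite /= ltnn.
rewrite /inversions big_set1 big1 ?expr0 ?scale1r => [|j].
  by congr (ext_mon k _); apply/setP => j; rewrite !inE.
by rewrite inE => /il /= /ltnW ij; rewrite ltnNge ij.
Qed.

End ExteriorFacts.

(* The underlying space of the free module F = E g_1 + ... + E g_r; its       *)
(* grading, which depends on d, is given by [free_deg].                       *)
Notation free_module k n r := {ffun 'I_r -> exterior k n}.

Section FreeModule.
Variables (k : fieldType) (n r : nat).
Local Notation E := (exterior k n).
Local Notation F := (free_module k n r).
Implicit Types (M : {vspace F}) (d : 'I_r -> nat) (s : {set 'I_n}).

Definition free_act (a : E) (x : F) : F := [ffun i => a * x i].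

Definition free_gen (i : 'I_r) : F := [ffun j => (j == i)%:R].

Definition free_mon (i : 'I_r) s : F := free_act (ext_mon k s) (free_gen i).

Lemma free_monE i s :
  free_mon i s = [ffun j => if j == i then ext_mon k s else 0].
Proof.
by apply/ffunP => j; rewrite !ffunE; case: eqP; rewrite ?mulr1 ?mulr0.
Qed.

Definition ext_deg (j : nat) : {vspace E} :=
  (\sum_(s : {set 'I_n} | #|s| == j) <[ext_mon k s]>)%VS.

Definition free_deg d (j : nat) : {vspace F} :=
  (\sum_i \sum_(s : {set 'I_n} | (#|s| + d i == j)%N) <[free_mon i s]>)%VS.

(* An E-submodule is in particular a k-subspace; as F has finite dimension,   *)
(* taking these in {vspace F} is no restriction.                              *)
Definition is_submodule M : Prop :=
  forall (a : E) (x : F), x \in M -> free_act a x \in M.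

Definition is_generated_by (G : set F) M : Prop :=
  [/\ is_submodule M,
      forall x, G x -> x \in M &
      forall M', is_submodule M' -> (forall x, G x -> x \in M') -> (M <= M')%VS].

Definition monomials : set F := [set x | exists i s, x = free_mon i s]%classic.

Definition is_monomial_submodule M : Prop :=
  exists2 G : set F, (G `<=` monomials)%classic & is_generated_by G M.

Definition free_inj (i : 'I_r) (a : E) : F := free_act a (free_gen i).

Fact free_inj_is_linear i : linear (free_inj i).
Proof.
move=> c a b; apply/ffunP => j.
by rewrite !ffunE mulrDl scalerAl.
Qed.

HB.instance Definition _ i :=
  GRing.isLinear.Build k E F *:%R (free_inj i) (free_inj_is_linear i).

(* The ideal I_i of M = I_1 g_1 + ... + I_r g_r. *)
Definition component M (i : 'I_r) : {vspace E} :=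
  (linfun (free_inj i) @^-1: M)%VS.

Lemma mem_component M i a :
  (a \in component M i) = (free_act a (free_gen i) \in M).
Proof. by rewrite -memv_preim lfunE. Qed.

Definition is_proper M : Prop :=
  forall (i : 'I_r) (j : nat), (j <= 1)%N -> (component M i :&: ext_deg j = 0)%VS.

(* dim (F/M)_j for M graded, where (F/M)_j = F_j / (M :&: F_j). *)
Definition hilbert d M (j : nat) : nat :=
  (\dim (free_deg d j) - \dim (M :&: free_deg d j))%N.

Lemma hilbert_quotient (Q : vectType k) (p : 'Hom(F, Q)) d M j :
  lker p = M -> \dim (p @: free_deg d j) = hilbert d M j.
Proof.
by move=> <-; rewrite /hilbert -(limg_ker_dim p (free_deg d j)) capvC addKn.
Qed.

Definition hilbert_vector (N : nat) d M : 'rV[int]_N.+1 :=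
  \row_j (hilbert d M j)%:Z.

End FreeModule.

Section SimplicialComplexes.
Variable n : nat.
Implicit Type D : {set {set 'I_n}}.

Definition is_complex D : Prop :=
  [/\ set0 \in D,
      forall i : 'I_n, [set i]%SET \in D &
      forall s t : {set 'I_n}, s \in D -> t \subset s -> t \in D].

(* Integer indices, so that the value is 0 for j < 0 and for j > n. *)
Definition face_number D (j : int) : nat :=
  #|[set s in D | #|s|%:Z == j]%SET|.

Definition f_vector D : 'rV[int]_n.+1 := \row_j (face_number D j%:Z)%:Z.

Definition f_vectors : set 'rV[int]_n.+1 :=
  [set f_vector D | D in [set D | is_complex D]]%classic.

Definition ff_vector r (N : nat) (d : 'I_r -> nat)
    (D : 'I_r -> {set {set 'I_n}}) : 'rV[int]_N.+1 :=
  \row_j (\sum_(i < r) face_number (D i) (j%:Z - (d i)%:Z))%:Z.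

End SimplicialComplexes.

Arguments f_vectors n : clear implicits.

Definition shift (R : pzSemiRingType) (n N d : nat) (v : 'rV[R]_n.+1) :
    'rV[R]_N.+1 :=
  v *m \matrix_(i, j) (j == (i + d)%N :> nat)%:R.

Arguments shift {R n} N d v.

Definition minkowski_add (V : zmodType) (A B : set V) : set V :=
  [set x + y | x in A & y in B]%classic.

Notation "\minkowski_ ( i < r ) A" :=
  (\big[@minkowski_add _ / [set 0]%classic]_(i < r) A%classic)
  (at level 41, A at level 41, i, r at level 50).

(* Main.v *)
(* A monomial submodule is the span of the monomials it contains, and the index
   set of these is closed under enlarging the exterior part.  So the monomials
   e_s g_i outside M form, for each i, a family of sets closed under taking subsets,
   which contains the empty set and all singletons exactly when M is proper; conversely every
   r-vector of complexes arises in this way.  The monomials outside M are also a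
   basis of F/M, so counting them by degree gives the Hilbert function. *)
Require Import Defs.
From mathcomp Require Import all_boot all_order all_algebra.
From mathcomp Require Import all_classical.

Set Implicit Arguments.
Unset Strict Implicit.
Unset Printing Implicit Defensive.

Import Order.TTheory GRing.Theory Num.Theory.
Local Open Scope ring_scope.

(** * Coefficients in the exterior algebra *)

Section ExteriorCoefficients.
Variables (k : fieldType) (n : nat).
Implicit Types s t u : {set 'I_n}.

Lemma ext_coef_sum (J : finType) (A : pred J) (f : J -> exterior k n) s :
  ext_coef (\sum_(j | A j) f j) s = \sum_(j | A j) ext_coef (f j) s.
Proof. by rewrite {1}/ext_coef sum_ffunE. Qed.

Lemma ext_coef0 s : ext_coef (0 : exterior k n) s = 0.
Proof. exact: ffunE. Qed.

(** A product [e_s e_t] is zero or a signed [e_(s U t)], so every monomial of [a * b] is a multiple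
    of a monomial of [b]. *)
Lemma ext_mul_coef_neq0 (a b : exterior k n) u :
  ext_coef (a * b) u != 0 -> exists2 t : {set 'I_n}, t \subset u & ext_coef b t != 0.
Proof.
move=> abu; apply/exists_inP; apply: contraR abu; rewrite negb_exists_in.
move=> /forall_inP b0; apply/eqP.
rewrite [a * b]/(ext_mul a b) /ext_mul ext_coef_sum big1 // => s _.
rewrite ext_coef_sum big1 // => t _; rewrite ext_coefZ.
have [tu|ntu] := boolP (t \subset u).
  by have /negPn/eqP -> := b0 t tu; rewrite mulr0 mul0r.
rewrite /ext_mon_mul; case: ifP => _; last by rewrite ext_coef0 mulr0.
rewrite ext_coefZ ext_coef_mon; case: eqP => [ust|_]; last by rewrite !mulr0.
by rewrite ust finset.subsetUr in ntu.
Qed.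

Lemma ext_mon_neq0 s : ext_mon k s != 0.
Proof.
apply/eqP => /(congr1 (fun a => ext_coef a s)) /eqP.
by rewrite ext_coef_mon eqxx ext_coef0 oner_eq0.
Qed.

Lemma mem_ext_mon_deg s : ext_mon k s \in ext_deg k n #|s|.
Proof. by rewrite memvE; apply: (sumv_sup s). Qed.

Lemma mem_ext_deg_coef j (a : exterior k n) s :
  a \in ext_deg k n j -> #|s| != j -> ext_coef a s = 0.
Proof.
move=> /memv_sumP[v vj ->] nsj; rewrite ext_coef_sum big1 // => t /eqP tj.
have /vlineP[c ->] := vj t (introT eqP tj).
rewrite ext_coefZ ext_coef_mon.
by have [st|_] := eqVneq s t; [rewrite st tj eqxx in nsj | rewrite mulr0].
Qed.

End ExteriorCoefficients.

(** * Subspaces of the free module spanned by monomials *)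

Section MonomialSpan.
Variables (k : fieldType) (n r : nat).
Local Notation F := (free_module k n r).
Local Notation I := ('I_r * {set 'I_n})%type.
Implicit Types (i : 'I_r) (s t u : {set 'I_n}) (P Q : pred I).
Implicit Types (x : F) (p q : I) (M : {vspace F}).

Definition free_coef x p : k := ext_coef (x p.1) p.2.

Definition mon_span P : {vspace F} := (\sum_(p | P p) <[free_mon k p.1 p.2]>)%VS.

Lemma free_coefZ a x p : free_coef (a *: x) p = a * free_coef x p.
Proof. by rewrite /free_coef ffunE ext_coefZ. Qed.

Lemma free_coef0 p : free_coef 0 p = 0.
Proof. by rewrite -(scale0r (0 : F)) free_coefZ mul0r. Qed.

Lemma free_coef_sum (J : finType) (A : pred J) (f : J -> F) p :
  free_coef (\sum_(j | A j) f j) p = \sum_(j | A j) free_coef (f j) p.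
Proof.
apply: (big_morph (free_coef^~ p)) => [x y|]; last exact: free_coef0.
by rewrite /free_coef ffunE ext_coefD.
Qed.

Lemma free_coef_mon i s p : free_coef (free_mon k i s) p = (p == (i, s))%:R.
Proof.
case: p => j t; rewrite /free_coef free_monE ffunE xpair_eqE /=.
by case: eqP => _ /=; [exact: ext_coef_mon | exact: ext_coef0].
Qed.

Lemma free_coef_inj x y : free_coef x =1 free_coef y -> x = y.
Proof. by move=> xy; apply/ffunP => i; apply/ffunP => s; exact: (xy (i, s)). Qed.

Lemma free_expand x : x = \sum_p free_coef x p *: free_mon k p.1 p.2.
Proof.
apply: free_coef_inj => p; rewrite free_coef_sum (bigD1 p) //= big1 => [|q nqp].
  by rewrite addr0 free_coefZ free_coef_mon -surjective_pairing eqxx mulr1.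
by rewrite free_coefZ free_coef_mon -surjective_pairing eq_sym (negPf nqp) mulr0.
Qed.

Lemma free_mon_neq0 i s : free_mon k i s != 0.
Proof.
apply/eqP => /(congr1 (free_coef^~ (i, s))) /eqP.
by rewrite free_coef_mon free_coef0 eqxx oner_eq0.
Qed.

Lemma mem_mon_span P x :
  reflect (forall p, ~~ P p -> free_coef x p = 0) (x \in mon_span P).
Proof.
apply: (iffP idP) => [/memv_sumP[v vP ->] p nPp|xP].
  rewrite free_coef_sum big1 // => q Pq.
  have /vlineP[c ->] := vP q Pq; rewrite free_coefZ free_coef_mon.
  rewrite -surjective_pairing; case: eqP => [pq|_]; last by rewrite mulr0.
  by rewrite pq Pq in nPp.
rewrite (free_expand x) (bigID P) /= [X in _ + X]big1 => [|p /xP->]; last first.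
  by rewrite scale0r.
by rewrite addr0; apply: memv_sumr => p _; rewrite memvZ ?memv_line.
Qed.

Lemma free_mon_span P i s : (free_mon k i s \in mon_span P) = P (i, s).
Proof.
apply/mem_mon_span/idP => [H|Pis p nPp].
  apply: contraT => /H /eqP.
  by rewrite free_coef_mon eqxx oner_eq0.
rewrite free_coef_mon; case: eqP => // pis.
by rewrite pis Pis in nPp.
Qed.

(** In a vanishing sum of vectors from the lines, the coefficient at [p] sees only the term at [p];
    so the lines are independent. *)
Lemma dim_mon_span P : \dim (mon_span P) = #|P|.
Proof.
suff /directvP/= -> : directv (mon_span P).
  rewrite -sum1_card; apply: eq_bigr => p _.
  by rewrite dim_vline free_mon_neq0.
apply/directv_sum_independent => v vP v0 p Pp.
have /vlineP[c vp] := vP p Pp.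
move/(congr1 (free_coef^~ p)): v0.
rewrite free_coef0 free_coef_sum (bigD1 p) //= big1 => [|q /andP[Pq nqp]].
  rewrite addr0 vp free_coefZ free_coef_mon -surjective_pairing eqxx mulr1.
  by move->; rewrite scale0r.
have /vlineP[b ->] := vP q Pq.
by rewrite free_coefZ free_coef_mon -surjective_pairing eq_sym (negPf nqp) mulr0.
Qed.

Lemma cap_mon_span P Q : (mon_span P :&: mon_span Q)%VS = mon_span (predI P Q).
Proof.
apply/vspaceP => x; rewrite memv_cap; apply/andP/mem_mon_span => [[]|xPQ].
  by move=> /mem_mon_span xP /mem_mon_span xQ p; rewrite negb_and => /orP[/xP|/xQ].
by split; apply/mem_mon_span => p /negPf Pp; apply: xPQ; rewrite /= Pp ?andbF.
Qed.

Lemma free_deg_mon_span (d : 'I_r -> nat) j :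
  free_deg k n d j = mon_span [pred p : I | #|p.2| + d p.1 == j]%N.
Proof. by rewrite /free_deg pair_big_dep. Qed.

Lemma hilbert_mon_span (d : 'I_r -> nat) P j :
  hilbert d (mon_span P) j = #|[pred p : I | ~~ P p & #|p.2| + d p.1 == j]%N|.
Proof.
rewrite /hilbert free_deg_mon_span cap_mon_span !dim_mon_span.
set A := [pred p | _].
(* The degree [j] monomials split into those inside and outside [P]; the subtraction in [hilbert]
   cancels the former. *)
rewrite -[#|A|](cardID P) (eq_card (_ : predI P A =i predI A P)) => [|p].
  by rewrite addKn; apply: eq_card => p; rewrite !inE.
by rewrite !inE andbC.
Qed.

(** * Monomial submodules as upward closed families *)

Definition upclosed P :=
  forall i (s t : {set 'I_n}), s \subset t -> P (i, s) -> P (i, t).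

Lemma mon_span_submodule P : upclosed P -> is_submodule (mon_span P).
Proof.
move=> upP a x /mem_mon_span xP; apply/mem_mon_span => -[i u] nPu.
(* A nonzero coefficient at [u] comes from one of [x] at some [t] inside [u]; then [(i, t)] is in
   [P], which forces [(i, u)] into [P]. *)
apply/eqP; apply: contraT; rewrite /free_coef ffunE => /ext_mul_coef_neq0[t tu].
rewrite -[ext_coef _ _]/(free_coef x (i, t)) xP ?eqxx //.
by apply: contraNN nPu; exact: upP.
Qed.

Lemma mon_span_generated P : upclosed P ->
  is_generated_by [set x | exists2 p, P p & x = free_mon k p.1 p.2]%classic
    (mon_span P).
Proof.
move=> upP; split; first exact: mon_span_submodule.
  by move=> _ [[i s] Pp ->]; rewrite free_mon_span.
by move=> M _ GM; apply/subv_sumP => p Pp; rewrite -memvE; apply: GM; exists p.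
Qed.

Lemma free_act_mon (s t : {set 'I_n}) i : [disjoint t & s] ->
  free_act (ext_mon k t) (free_mon k i s) =
    (-1) ^+ inversions t s *: free_mon k i (t :|: s).
Proof.
move=> dts; apply/ffunP => j; rewrite !free_monE !ffunE.
by case: eqP => _; rewrite ?mulr0 ?scaler0 // ext_monM /ext_mon_mul dts.
Qed.

(** For [s] inside [t], [e_t g_i] is, up to an invertible sign, the multiple of [e_s g_i] by the
    monomial of [t :\: s]. *)
Lemma submodule_upclosed M : is_submodule M ->
  upclosed [pred p : I | free_mon k p.1 p.2 \in M].
Proof.
move=> subM i s t st /= sM.
have dts : [disjoint t :\: s & s].
  by apply/pred0P => x; rewrite /= !inE andbAC andNb.
have tE : t :\: s :|: s = t.
  apply/finset.setP => x; rewrite !inE.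
  by have [/(fintype.subsetP st) ->|_] := boolP (x \in s); rewrite ?orbT ?orbF.
have := subM (ext_mon k (t :\: s)) _ sM.
by rewrite free_act_mon // tE rpredZsign.
Qed.

(** The span of the monomials in [M] is a submodule containing the generators, so minimality of [M]
    gives the nontrivial inclusion. *)
Lemma monomial_submoduleE M : is_monomial_submodule M ->
  M = mon_span [pred p : I | free_mon k p.1 p.2 \in M].
Proof.
move=> [G Gmon [subM GM minM]]; apply/eqP; rewrite eqEsubv; apply/andP; split.
  apply: minM => [|x Gx]; first exact/mon_span_submodule/submodule_upclosed.
  by have [i [s xE]] := Gmon x Gx; rewrite xE free_mon_span /= -xE GM.
by apply/subv_sumP => p Pp; rewrite -memvE.
Qed.

Lemma is_properP P :
  is_proper (mon_span P) <->
  forall i (s : {set 'I_n}), (#|s| <= 1)%N -> ~~ P (i, s).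
Proof.
split=> [prop i s s1|nP i j j1].
  apply/negP => Pis; have := ext_mon_neq0 k s.
  rewrite -memv0 -(prop i _ s1) memv_cap mem_component.
  by rewrite [free_act _ _ \in _]free_mon_span Pis mem_ext_mon_deg.
apply/eqP; rewrite -subv0; apply/subvP => a; rewrite memv_cap mem_component memv0.
move=> /andP[/mem_mon_span aP aj]; apply/eqP/ffunP => s.
(* Homogeneity kills the coefficients off degree [j]; those in degree [j] vanish because [P] has no
   set of that size. *)
rewrite [RHS]ffunE; have [sj|nsj] := eqVneq #|s| j; last exact: mem_ext_deg_coef aj nsj.
have /aP : ~~ P (i, s) by apply: nP; rewrite sj.
by rewrite /free_coef !ffunE eqxx mulr1.
Qed.

(** * Correspondence with vectors of complexes *)

Lemma hilbert_faces (d : 'I_r -> nat) (D : 'I_r -> {set {set 'I_n}}) j :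
  hilbert d (mon_span [pred p : I | p.2 \notin D p.1]) j =
  (\sum_(i < r) face_number (D i) (j%:Z - (d i)%:Z))%N.
Proof.
rewrite hilbert_mon_span -sum1_card.
rewrite [RHS](eq_bigr (fun i => \sum_(s in D i | #|s| + d i == j) 1)%N) => [|i _].
  by rewrite pair_big_dep; apply: eq_bigl => p; rewrite !inE negbK.
rewrite /face_number -sum1_card; apply: eq_bigl => s.
(* The difference is taken in the integers, so nothing is truncated: for [j < d i] neither side
   counts a face. *)
by rewrite !inE eq_sym subr_eq eq_sym -PoszD eqz_nat.
Qed.

Lemma submodule_complex M : is_monomial_submodule M -> is_proper M ->
  exists2 D : 'I_r -> {set {set 'I_n}},
    forall i, is_complex (D i) & M = mon_span [pred p : I | p.2 \notin D p.1].
Proof.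
(* This is the Stanley-Reisner complex of the ideal [component M i]: its faces index the monomials
   surviving in the quotient. *)
move=> monM propM; pose D i := [set s | free_mon k i s \notin M]%SET.
have ME : M = mon_span [pred p : I | p.2 \notin D p.1].
  by rewrite {1}(monomial_submoduleE monM); apply: eq_bigl => p; rewrite !inE negbK.
exists D => // i; move: propM; rewrite ME => /is_properP propM.
have {}propM s : (#|s| <= 1)%N -> s \in D i by move=> /(propM i); rewrite /= negbK.
split=> [|v|s t].
- by apply: propM; rewrite cards0.
- by apply: propM; rewrite cards1.
rewrite !inE => sM ts; apply: contraNN sM.
by case: monM => G _ [subM _ _]; apply: (submodule_upclosed subM).
Qed.

(** Nonfaces are upward closed, hence span a submodule; properness holds since all sets of size at
    most one are faces. *)
Lemma complex_submodule (D : 'I_r -> {set {set 'I_n}}) :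
  (forall i, is_complex (D i)) ->
  let M := mon_span [pred p : I | p.2 \notin D p.1] in
  is_monomial_submodule M /\ is_proper M.
Proof.
move=> cD M; split.
  eexists; last first.
    apply: mon_span_generated => i s t st; apply: contraNN => tD.
    by have [_ _ /(_ t s tD st)] := cD i.
  by move=> _ [[i s] _ ->]; exists i, s.
apply/is_properP => i s; rewrite /= negbK; have [D0 D1 _] := cD i.
have [->|[v vs] s1] := set_0Vmem s; first by rewrite D0.
suff -> : s = [set v]%SET by [].
by apply/eqP; rewrite eq_sym eqEcard finset.sub1set vs cards1.
Qed.

End MonomialSpan.

(** * Shifted f-vectors and Minkowski sums *)

Lemma face_number_shift n (D : {set {set 'I_n}}) N e (j : 'I_N.+1) :
  shift N e (f_vector D) 0 j = (face_number D (j%:Z - e%:Z))%:Z.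
Proof.
(* Column [j] of the shift matrix has a nonzero entry only in this window, at row [j - e]; outside
   it both sides vanish. *)
rewrite mxE; have [/andP[ej jn]|nj] := boolP (e <= j < n.+1 + e)%N.
  have jen : (j - e < n.+1)%N by rewrite ltn_subLR // addnC.
  rewrite (bigD1 (Ordinal jen)) //= big1 ?addr0 => [|i nij].
    by rewrite !mxE /= subnK // eqxx mulr1 subzn.
  rewrite !mxE; case: eqP => [jie|_]; last by rewrite mulr0.
  by case/eqP: nij; apply: val_inj; rewrite /= jie addnK.
rewrite big1 => [|i _]; last first.
  rewrite !mxE; case: eqP => [jie|_]; last by rewrite mulr0.
  by rewrite jie leq_addl ltn_add2r ltn_ord in nj.
(* A face of size [j - e] would have at most [n] elements, putting [j] back in the window. *)
congr Posz; apply/esym/eqP; rewrite cards_eq0; apply/set0Pn => -[s].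
rewrite !inE => /andP[_]; rewrite eq_sym subr_eq eqz_nat => /eqP je.
by rewrite je leq_addl ltn_add2r ltnS -[X in (_ <= X)%N]card_ord max_card in nj.
Qed.

Lemma ff_vector_sum n r N (d : 'I_r -> nat) (D : 'I_r -> {set {set 'I_n}}) :
  ff_vector N d D = \sum_i shift N (d i) (f_vector (D i)).
Proof.
apply/rowP => j; rewrite mxE summxE (raddf_sum Posz).
by apply: eq_bigr => i _; rewrite face_number_shift.
Qed.

Local Open Scope classical_set_scope.

Lemma mem_minkowski (V : zmodType) r (A : 'I_r -> set V) x :
  (\minkowski_(i < r) A i) x <->
  exists2 y : 'I_r -> V, forall i, A i (y i) & x = \sum_i y i.
Proof.
elim: r A x => [|r IHr] A x.
  rewrite big_ord0; split=> [->|[y _ ->]]; last by rewrite big_ord0.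
  by exists (fun=> 0) => [[]|]; rewrite ?big_ord0.
rewrite big_ord_recl; split=> [[a Aa [b /IHr[y Ay ->] <-]]|[y Ay ->]].
  (* The summand split off goes to index [ord0], the inductive family to the lifted indices. *)
  exists (fun i => if unlift ord0 i is Some j then y j else a) => [i|].
    by case: unliftP => [j|] ->.
  by rewrite big_ord_recl unlift_none; under [in RHS]eq_bigr do rewrite liftK.
exists (y ord0) => //; exists (\sum_(i < r) y (lift ord0 i)).
  by apply/IHr; exists (fun i => y (lift ord0 i)).
by rewrite big_ord_recl.
Qed.

Theorem proposition35 (k : fieldType) (n r : nat) (d : 'I_r.+1 -> nat)
    (n_gt0 : (0 < n)%N) (d0 : d ord0 = 0%N)
    (d_mono : forall i j : 'I_r.+1, (i <= j)%N -> (d i <= d j)%N) :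
  let N := (n + d ord_max)%N in
  let hilbert_vectors : set 'rV[int]_N.+1 :=
    [set hilbert_vector N d M | M in
      [set M : {vspace free_module k n r.+1} |
        is_monomial_submodule M /\ is_proper M]] in
  let ff_vectors : set 'rV[int]_N.+1 :=
    [set ff_vector N d D | D in
      [set D : 'I_r.+1 -> {set {set 'I_n}} | forall i, is_complex (D i)]] in
  let minkowski_sum : set 'rV[int]_N.+1 :=
    \minkowski_(i < r.+1) (shift N (d i) @` f_vectors n) in
  [/\ hilbert_vectors = ff_vectors,
      hilbert_vectors = minkowski_sum,
      ff_vectors = minkowski_sum &
      forall i : 'I_r.+1, finite_set (shift N (d i) @` f_vectors n)].
Proof.
move=> N hilbert_vectors ff_vectors minkowski_sum.
have hilbert_ff (D : 'I_r.+1 -> {set {set 'I_n}}) :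
    hilbert_vector N d (mon_span k [pred p | p.2 \notin D p.1]) = ff_vector N d D.
  by apply/rowP => j; rewrite !mxE hilbert_faces.
have hf : hilbert_vectors = ff_vectors.
  apply/seteqP; split=> [_ [M [monM propM] <-]|_ [D cD <-]].
    have [D cD ->] := submodule_complex monM propM.
    by rewrite hilbert_ff; exists D.
  by rewrite -hilbert_ff; eexists => //; exact: complex_submodule.
have fm : ff_vectors = minkowski_sum.
  apply/seteqP; split=> [_ [D cD <-]|x /mem_minkowski[y yS ->]].
    apply/mem_minkowski; exists (fun i => shift N (d i) (f_vector (D i))).
      by move=> i; exists (f_vector (D i)) => //; exists (D i) => //; exact: cD.
    exact: ff_vector_sum.
  (* The complexes are given one index at a time; as they may be chosen independently, choice
     assembles them into a tuple. *)
  have /boolp.choice[D DP] : forall i, exists D : {set {set 'I_n}},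
      is_complex D /\ shift N (d i) (f_vector D) = y i.
    by move=> i; have [_ [D cD <-] <-] := yS i; exists D.
  exists D => [i|]; first by have [] := DP i.
  by rewrite ff_vector_sum; apply: eq_bigr => i _; have [] := DP i.
split; rewrite ?hf // => i.
(* Two images, under [f_vector] and [shift], of a set of families of subsets of a finite type. *)
by do 2!apply: finite_image; exact: finite_finset.
Qed.
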